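(* Let $\mathbb{K}$ be a field and let $\Delta$ be a simplicial complex on vertex set $[n]=\{1,\dots,n\}$. The Betti diagram $\beta(I_{\Delta^*})$ is pure if and only if $\Delta$ satisfies the following condition: for every $i\ge-1$ and all faces $\sigma,\tau\in\Delta$, if $\widetilde{H}_i(\mathrm{link}_\Delta\sigma)\neq0\neq\widetilde{H}_i(\mathrm{link}_\Delta\tau)$ then $|\sigma|=|\tau|$.
   Context: A simplicial complex on $[n]$ is a set of subsets of $[n]$ closed under taking subsets. $\widetilde{H}_i$ denotes reduced simplicial homology with coefficients in $\mathbb{K}$ (the complex $\{\emptyset\}$ has $\widetilde{H}_{-1}=\mathbb{K}$). For $\sigma\in\Delta$, $\mathrm{link}_\Delta\sigma=\{\tau\in\Delta:\sigma\cap\tau=\emptyset,\ \sigma\cup\tau\in\Delta\}$. The Alexander dual is $\Delta^*=\{F\subseteq[n]:[n]\setminus F\notin\Delta\}$. In $R=\mathbb{K}[x_1,\dots,x_n]$ (standard graded), $I_{\Delta^*}=\langle\prod_{i\in\sigma}x_i:\sigma\subseteq[n],\ [n]\setminus\sigma\in\Delta\rangle$ is the Stanley-Reisner ideal of $\Delta^*$. Its graded Betti numbers $\beta_{i,d}$ are the exponents in its minimal graded free resolution as an $R$-module, and the diagram $\beta(I_{\Delta^*})=(\beta_{i,d})$ is pure if for every $i$ there is at most one $c$ with $\beta_{i,c}\ne0$. *)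

(* Defs.v *)
From Stdlib Require Import ClassicalEpsilon.
From HB Require Import structures.
From mathcomp Require Import all_boot all_order all_algebra.
From mathcomp Require Import mpoly.

Set Implicit Arguments.
Unset Strict Implicit.
Unset Printing Implicit Defensive.

Import GRing.Theory.
Local Open Scope ring_scope.

(* [n] = {1, ..., n} is represented by 'I_n = {0, ..., n-1}. *)
Section Complexes.
Variable n : nat.
Implicit Types (D : {set {set 'I_n}}) (s t : {set 'I_n}).

(* Both the void complex set0 and the complex [set set0] are allowed. *)
Definition simplicial_complex D : Prop :=
  forall s t, s \in D -> t \subset s -> t \in D.

Definition link D s : {set {set 'I_n}} :=
  [set t in D | (s :&: t == set0) && (s :|: t \in D)].

Definition alexander_dual D : {set {set 'I_n}} := [set s | ~: s \notin D].

End Complexes.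

(* Reduced simplicial homology.  All chain groups of complexes on 'I_n live in
   one space with basis the subsets of 'I_n; the empty face has dimension -1,
   so the differential in degree 0 is the augmentation. *)
Section Homology.
Variables (K : fieldType) (n : nat).
Implicit Types (D : {set {set 'I_n}}) (s t : {set 'I_n}).

Definition chain := {ffun {set 'I_n} -> K^o}.

Definition elementary_chain s : chain := [ffun t => (t == s)%:R].

(* #|[set u in s | u < v]| is the position of v in the increasing
   enumeration of s. *)
Definition face_boundary s : chain :=
  \sum_(v in s)
     ((-1) ^+ #|[set u in s | (u < v)%N]| : K) *: elementary_chain (s :\ v).

Definition boundary_fun (c : chain) : chain :=
  \sum_(s : {set 'I_n}) (c s : K) *: face_boundary s.

Fact boundary_fun_is_linear : linear boundary_fun.
Proof.
move=> a c e; rewrite /boundary_fun scaler_sumr -big_split /=.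
by apply: eq_bigr => s _; rewrite !ffunE scalerDl scalerA.
Qed.

HB.instance Definition _ :=
  GRing.isLinear.Build K chain chain _ boundary_fun boundary_fun_is_linear.

Definition boundary : 'End(chain) := linfun boundary_fun.

Definition chains D (i : int) : {vspace chain} :=
  <<[seq elementary_chain s | s <- enum D & (#|s|%:Z == i + 1)%R]>>%VS.

Definition cycles D (i : int) : {vspace chain} :=
  (chains D i :&: lker boundary)%VS.

Definition boundaries D (i : int) : {vspace chain} :=
  (boundary @: chains D (i + 1)%R)%VS.

(* The quotient of cycles by boundaries, realized as a complement of the
   boundaries in the space of cycles. *)
Definition reduced_homology D (i : int) : {vspace chain} :=
  (cycles D i :\: boundaries D i)%VS.

End Homology.

Arguments reduced_homology K {n} D i.

Section StanleyReisner.
Variables (K : fieldType) (n : nat).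

Definition face_monomial (s : {set 'I_n}) : {mpoly K[n]} := \prod_(i in s) 'X_i.

Definition stanley_reisner_ideal (D : {set {set 'I_n}}) (p : {mpoly K[n]}) :
    Prop :=
  exists c : {set 'I_n} -> {mpoly K[n]},
    p = \sum_(s : {set 'I_n} | s \notin D) c s * face_monomial s.

Fact notin_alexander_dual (D : {set {set 'I_n}}) (s : {set 'I_n}) :
  (s \notin alexander_dual D) = (~: s \in D).
Proof. by rewrite inE negbK. Qed.

End StanleyReisner.

Arguments stanley_reisner_ideal K {n} D p.

Section Resolutions.
Variables (K : fieldType) (n : nat).
Local Notation R := {mpoly K[n]}.

(* Data of a complex ... -> F_1 -> F_0 -> R of finite free graded modules
   F_i = \bigoplus_j R(- shift i j), with elements of F_i written as row
   vectors; res_diff i maps F_(i+1) to F_i.  Natural shifts suffice for an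
   ideal I of R: the minimal generators of I have degree >= 0, and shifts do
   not decrease along a minimal resolution. *)
Record free_complex := FreeComplex {
  res_rank : nat -> nat;
  res_shift : forall i, 'I_(res_rank i) -> nat;
  res_aug : 'cV[R]_(res_rank 0);
  res_diff : forall i, 'M[R]_(res_rank i.+1, res_rank i)
}.

(* F is a complex with differentials of degree 0. *)
Definition graded_free_complex (F : free_complex) : Prop :=
  (forall j, res_aug F j 0 \is (res_shift j).-homog) /\
  (forall i j k, {in msupp (res_diff F i j k), forall m,
     (mdeg m + res_shift k = res_shift j)%N}).

Definition resolves (I : R -> Prop) (F : free_complex) : Prop :=
  [/\ forall p, I p <-> exists v : 'rV_(res_rank F 0), p = (v *m res_aug F) 0 0,
      forall v : 'rV_(res_rank F 0),
        v *m res_aug F = 0 <-> exists w, v = w *m res_diff F 0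
    & forall i (v : 'rV_(res_rank F i.+1)),
        v *m res_diff F i = 0 <-> exists w, v = w *m res_diff F i.+1].

(* The image of each F_(i+1) -> F_i lies in (x_1, ..., x_n) F_i. *)
Definition minimal_complex (F : free_complex) : Prop :=
  forall i j k, (res_diff F i j k)@_0%MM = 0.

Definition minimal_graded_free_resolution (I : R -> Prop) (F : free_complex) :
    Prop :=
  [/\ graded_free_complex F, resolves I F & minimal_complex F].

Definition resolution_betti (F : free_complex) (i d : nat) : nat :=
  #|[set j : 'I_(res_rank F i) | res_shift j == d]|.

(* betti I i d is beta_{i,d}(I), read off a minimal graded free resolution of
   the homogeneous ideal I; such a resolution exists and is unique up to
   isomorphism, so the choice of one is immaterial. *)
Definition betti (I : R -> Prop) : nat -> nat -> nat :=
  epsilon (inhabits (fun _ _ : nat => 0%N))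
    (fun b => exists2 F : free_complex,
       minimal_graded_free_resolution I F & b = resolution_betti F).

End Resolutions.

Definition pure_diagram (b : nat -> nat -> nat) : Prop :=
  forall i c d, b i c <> 0%N -> b i d <> 0%N -> c = d.

(* Main.v *)
(* The dual Hochster formula (Eagon-Reiner): [beta_{i,d}(I)] is nonzero for
   [I = I_{D*}] exactly when some face [s] of [D] with [n - |s| = d] has
   nonzero reduced homology of its link in degree [i - 1]; both sides of the
   equivalence then say the same thing.  Only vanishing is compared, so
   [Tor_i(M, K)_d = 0] is expressed elementwise, as exactness of the Koszul
   complex of [M] in homological degree [i] and internal degree [d].

   In a free module, the strand of the Koszul complex of multidegree [b <> 0]
   is a cone, hence exact.  Along [0 -> ker A -> R^r -> im A -> 0] with
   [ker A] inside [(x_1, ..., x_n) R^r], exactness therefore shifts degree, and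
   in homological degree 0 it says that no generator has degree [d]; so a
   minimal resolution has a generator of degree [d] in step [i] iff [I] is not
   exact at [(i, d)].  For [I] itself the strand of multidegree [b] is the
   chain complex of the upper Koszul complex: a cone if [b] is not squarefree,
   the link of the complement of the support of [b] otherwise.

   Exactness for [d > n] also replaces Noetherianity in the existence of a
   minimal resolution: each syzygy module is generated in degrees at most [n],
   so by finitely many elements, and a generating family that cannot be
   shortened is minimal. *)
Require Import Defs.
From mathcomp Require Import all_boot all_order all_algebra.
From mathcomp Require Import mpoly.
From mathcomp Require Import zify.
From Stdlib Require Import Classical ClassicalEpsilon.

Set Implicit Arguments.
Unset Strict Implicit.
Unset Printing Implicit Defensive.

Import GRing.Theory.
Local Open Scope ring_scope.

(** * The Koszul differential *)

Section KoszulDifferential.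
Variables (S : comNzRingType) (V : lmodType S) (n : nat) (x : 'I_n -> S).
Implicit Types (c : {set 'I_n} -> V) (s t : {set 'I_n}).

Definition ksign (v : 'I_n) t : S := (-1) ^+ #|[set u in t | (u < v)%N]|.

(** A Koszul chain [\sum_s c s e_s] is encoded by its coefficients, so the differential is read off
    at each target face [t]. With all [x v = 1] it is the simplicial boundary. *)
Definition kdiff c t : V := \sum_(v | v \notin t) (ksign v t * x v) *: c (v |: t).

(** Exterior multiplication by [e_v], used as a contracting homotopy. *)
Definition kcone (v : 'I_n) c s : V :=
  if v \in s then ksign v (s :\ v) *: c (s :\ v) else 0.

Lemma eq_kdiff c1 c2 : c1 =1 c2 -> kdiff c1 =1 kdiff c2.
Proof. by move=> E t; apply: eq_bigr => v _; rewrite E. Qed.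

Lemma kdiff0 : kdiff (fun=> 0) =1 fun=> 0.
Proof. by move=> t; rewrite /kdiff big1 // => v _; rewrite scaler0. Qed.

Lemma kdiffB c1 c2 t : kdiff (fun s => c1 s - c2 s) t = kdiff c1 t - kdiff c2 t.
Proof. by rewrite /kdiff -sumrB; apply: eq_bigr => v _; rewrite scalerBr. Qed.

Lemma ksignU u v t : u \notin t -> ksign v (u |: t) = (-1) ^+ (u < v)%N * ksign v t.
Proof.
move=> ut; rewrite /ksign -exprD; congr (_ ^+ _).
have -> : [set w in u |: t | (w < v)%N] =
    (if (u < v)%N then [set u] else set0) :|: [set w in t | (w < v)%N].
  apply/setP=> w; rewrite !inE; case: (eqVneq w u) => [->|wu] /=.
    by case: ifP; rewrite !inE ?eqxx ?andbF.
  by case: ifP; rewrite !inE ?(negPf wu).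
by case: ifP => _; rewrite ?set0U // cardsU1 inE (negPf ut).
Qed.

Lemma ksign_sqr v t : ksign v t * ksign v t = 1.
Proof. by rewrite /ksign -exprD addnn -mul2n exprM sqrrN !expr1n. Qed.

Lemma ksign_anti u v t : u != v -> u \notin t -> v \notin t ->
  ksign v t * ksign u (v |: t) = - (ksign u t * ksign v (u |: t)).
Proof.
move=> uv ut vt; rewrite !ksignU //.
have : (u < v)%N != (v < u)%N by move: uv; rewrite -val_eqE /=; case: ltngtP.
case: (u < v)%N; case: (v < u)%N => //= _;
  rewrite ?expr0 ?expr1 ?mul1r ?mulN1r ?mulrN ?opprK; by rewrite mulrC.
Qed.

Lemma ksign_antiU u v t : u != v -> u \notin t -> v \notin t ->
  ksign u (v |: t) * ksign v (u |: t) = - (ksign u t * ksign v t).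
Proof.
move=> uv ut vt; rewrite !ksignU //.
have : (u < v)%N != (v < u)%N by move: uv; rewrite -val_eqE /=; case: ltngtP.
by case: (u < v)%N; case: (v < u)%N => //= _;
  rewrite ?expr0 ?expr1 ?mul1r ?mulN1r ?mulrN ?mulNr.
Qed.

(** Terms at [u, v] and [v, u] are matched by splitting on [u < v]; that the sum equals its own
    opposite would not suffice in characteristic 2. *)
Lemma sum_antisym (P : pred 'I_n) (F : 'I_n -> 'I_n -> V) :
    (forall u v, P u -> P v -> u != v -> F u v = - F v u) ->
  \sum_(v | P v) \sum_(u | P u && (u != v)) F v u = 0.
Proof.
move=> Fanti.
have -> : \sum_(v | P v) \sum_(u | P u && (u != v)) F v u =
   \sum_(v | P v) \sum_(u | P u && (u < v)%N) F v u +
   \sum_(v | P v) \sum_(u | P u && (v < u)%N) F v u.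
  rewrite -big_split /=; apply: eq_bigr => v Pv.
  rewrite (bigID (fun u : 'I_n => (u < v)%N)) /=; congr (_ + _);
    by apply: eq_bigl => u; rewrite -val_eqE /=; case: ltngtP; rewrite ?andbF ?andbT.
rewrite [X in _ + X](exchange_big_dep P) /=; last by move=> v u _ /andP[].
rewrite -big_split big1 //= => v Pv.
rewrite [X in _ + X](eq_bigl (fun u => P u && (u < v)%N)); last by move=> u; rewrite Pv.
rewrite -big_split big1 //= => u /andP[Pu uv].
by rewrite (Fanti v u) ?addNr // -val_eqE neq_ltn uv orbT.
Qed.

Lemma kdiffK c t : kdiff (kdiff c) t = 0.
Proof.
pose F v u := (ksign v t * ksign u (v |: t) * (x v * x u)) *: c (u |: (v |: t)).
transitivity (\sum_(v | v \notin t) \sum_(u | (u \notin t) && (u != v)) F v u).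
  apply: eq_bigr => v vt; rewrite scaler_sumr; apply: eq_big => [u|u _].
    by rewrite !inE negb_or andbC.
  by rewrite scalerA mulrACA.
apply: (@sum_antisym (fun v => v \notin t)) => u v ut vt uv.
by rewrite /F setUCA (ksign_anti (u := v)) // 1?eq_sym // mulNr scaleNr [x v * _]mulrC.
Qed.

(** The vertex [v] itself contributes [x v *: c t]; when [v] is in [t], the other vertices
    contribute opposite terms by [ksign_antiU]. *)
Lemma kdiff_kcone v c t : kdiff (kcone v c) t + kcone v (kdiff c) t = x v *: c t.
Proof.
rewrite {2}/kcone; case: ifP => vt; last first.
  rewrite addr0 /kdiff (bigD1 v) ?vt //= big1 ?addr0 => [|u /andP[ut uv]]; last first.
    by rewrite /kcone !inE eq_sym (negPf uv) vt scaler0.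
  rewrite /kcone setU11 setU1K ?vt // scalerA.
  by rewrite mulrAC ksign_sqr mul1r.
set t' := t :\ v; have tE : v |: t' = t := setD1K vt.
have vt' : v \notin t' by rewrite !inE eqxx.
rewrite {2}/kdiff (bigD1 v) //= scalerDr scalerA mulrA ksign_sqr mul1r tE addrCA.
rewrite -[RHS]addr0; congr (_ + _); rewrite scaler_sumr /kdiff.
rewrite (eq_bigl (fun u => (u \notin t') && (u != v))) => [|u]; last first.
  by rewrite !inE; case: eqP => [->|]; rewrite ?vt ?andbF ?andbT.
rewrite -big_split big1 //= => u /andP[ut' uv].
have E : (u |: t) :\ v = u |: t' by rewrite -tE setUCA setU1K // in_setU1 negb_or eq_sym uv vt'.
rewrite /kcone !inE vt orbT E !scalerA -scalerDl.
rewrite -{1}tE mulrAC mulrA -mulrDl ksign_antiU // [ksign u t' * _]mulrC.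
by rewrite addNr mul0r scale0r.
Qed.

End KoszulDifferential.

Lemma exists_fun (A B : Type) (Q : A -> B -> Prop) :
  (forall a, exists b, Q a b) -> exists f, forall a, Q a (f a).
Proof.
move=> H; exists (fun a => proj1_sig (constructive_indefinite_description _ (H a))).
by move=> a; case: constructive_indefinite_description.
Qed.

Lemma exists_fun2 (A B C : Type) (Q : A -> B -> C -> Prop) :
  (forall a b, exists c, Q a b c) -> exists f, forall a b, Q a b (f a b).
Proof.
by move=> H; have [f fP] := exists_fun (fun a => exists_fun (H a)); exists f.
Qed.

(** * Strands of the Koszul complex *)

Section Koszul.
Variables (K : fieldType) (n : nat).
Local Notation R := {mpoly K[n]}.
Implicit Types (s t : {set 'I_n}) (b m : 'X_{1..n}).

Local Notation koszul := (kdiff (fun v : 'I_n => 'X_v : R)).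
Local Notation simp := (@kdiff K K^o n (fun _ => 1)).

Lemma mcoeffXM (v : 'I_n) (p : R) m :
  ('X_v * p)@_m = if m v == 0%N then 0 else p@_(m - U_(v)).
Proof.
case: ifPn => [mv|mv].
  apply: memN_msupp_eq0; rewrite mulrC (perm_mem (msuppMX _ _)).
  apply/mapP=> -[m' _ mE]; move/eqP: mv; rewrite mE mnmDE mnm1E eqxx.
  by rewrite add1n.
have {1}<- : (U_(v) + (m - U_(v)))%MM = m by rewrite addmC submK ?lep1mP.
by rewrite mulrC mcoeffMX.
Qed.

Lemma mesym1_leU v t b : v \notin t ->
  (mesym1 (v |: t) <= b)%MM = (mesym1 t <= b)%MM && (b v != 0%N).
Proof.
move=> vt; apply/mnm_lepP/andP => [H|[/mnm_lepP H bv] i].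
  split; last by have := H v; rewrite mnmE setU11 lt0n.
  by apply/mnm_lepP=> i; have := H i; rewrite !mnmE inE; case: (i \in t); rewrite ?orbT.
have := H i; rewrite !mnmE !inE; case: eqP => [->|//]; by rewrite lt0n.
Qed.

Lemma mesym1U v t : v \notin t -> mesym1 (v |: t) = (U_(v) + mesym1 t)%MM.
Proof.
move=> vt; apply/mnmP=> i; rewrite mnmDE !mnmE !inE [v == i]eq_sym.
by case: eqP => // ->; rewrite (negPf vt).
Qed.

Lemma mdeg_sub_mesym1 s b : (mesym1 s <= b)%MM -> (mdeg (b - mesym1 s) + #|s| = mdeg b)%N.
Proof. by move=> sb; rewrite -mdeg_mesym1 -mdegD submK. Qed.

Section Coefficients.
Variable r : nat.
Implicit Types (c w : {set 'I_n} -> 'rV[R]_r) (j : 'I_r).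

(* The Koszul complex of a free module splits by multidegree [b]; the basis
   vector [x^(b-s) e_s] of multidegree [b] is identified with the face [s]. *)
Definition strand c j b s : K^o :=
  if (mesym1 s <= b)%MM then (c s 0 j)@_(b - mesym1 s) else 0.

Lemma strand_koszul c j b t : strand (koszul c) j b t = simp (strand c j b) t.
Proof.
rewrite {1}/strand; case: ifPn => tb; last first.
  rewrite /kdiff big1 // => v vt.
  by rewrite /strand mesym1_leU // (negPf tb) scaler0.
rewrite /kdiff summxE raddf_sum /=; apply: eq_bigr => v vt.
rewrite mxE mulr1 /strand mesym1_leU // tb /=.
have -> : (ksign R v t * 'X_v * c (v |: t) 0 j)@_(b - mesym1 t) =
    ksign K v t * ('X_v * c (v |: t) 0 j)@_(b - mesym1 t).
  rewrite /ksign -signr_odd -[in RHS]signr_odd.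
  by case: odd; rewrite ?expr1 ?expr0 ?mul1r // !mulN1r mulNr mcoeffN.
rewrite mcoeffXM mnmBE mnmE (negPf vt) subn0; case: ifPn => _ /=.
  by rewrite mulr0 scaler0.
rewrite mesym1U //; congr (_ * mcoeff _ _).
by apply/mnmP=> i; rewrite !mnmBE mnmDE subnDA subnAC.
Qed.

Lemma strand_inj c w : (forall j b s, strand c j b s = strand w j b s) -> c =1 w.
Proof.
move=> H s; apply/rowP=> j; apply/mpolyP=> m.
by have := H j (m + mesym1 s)%MM s; rewrite /strand lem_addl addmK.
Qed.

Lemma strand_bound c :
  exists N, forall j b s, (N <= mdeg b)%N -> strand c j b s = 0.
Proof.
pose F (p : {set 'I_n} * 'I_r) := msize (c p.1 0 p.2).
exists (n + \max_p F p)%N => j b s; rewrite /strand; case: ifP => // sb.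
rewrite -(mdeg_sub_mesym1 sb) => Nb; apply: memN_msupp_eq0; apply: msize_mdeg_ge.
have: (#|s| <= n)%N by rewrite -[X in (_ <= X)%N]card_ord max_card.
have: (msize (c s 0%R j) <= \max_p F p)%N by apply: (leq_bigmax (F := F) (s, j)).
by move: (\max_p F p) (msize _) (mdeg _) Nb => a1 a2 a3; lia.
Qed.

Definition assemble N (g : 'I_r -> 'X_{1..n} -> {set 'I_n} -> K) s : 'rV[R]_r :=
  \row_j \sum_(m : 'X_{1..n < N}) g j (m + mesym1 s)%MM s *: 'X_[m].

Lemma strand_assemble N g j b s :
    (mesym1 s <= b)%MM -> (forall b', (N <= mdeg b')%N -> g j b' s = 0) ->
  strand (assemble N g) j b s = g j b s.
Proof.
move=> sb gN; rewrite /strand sb mxE; case: (ltnP (mdeg (b - mesym1 s)) N) => Nb.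
  by rewrite (mcoeff_mpoly (fun m => g j (m + mesym1 s)%MM s)) // submK.
rewrite raddf_sum big1 /= => [|m _]; last first.
  rewrite mcoeffZ mcoeffX; case: eqP => [E|_]; last by rewrite mulr0.
  by rewrite -E leqNgt bmdeg in Nb.
by rewrite gN // -(mdeg_sub_mesym1 sb) (leq_trans Nb) // leq_addr.
Qed.

(** The equation is solved one multidegree at a time. Only finitely many strands of [c] are nonzero,
    and the others get the solution 0, so [w] is polynomial. The predicate [P] keeps [w] inside a
    monomial submodule. *)
Lemma koszul_lift c (P : 'I_r -> 'X_{1..n} -> Prop) :
    (forall j b, exists g : {set 'I_n} -> K,
       (forall s, g s != 0 -> (mesym1 s <= b)%MM /\ P j (b - mesym1 s)%MM) /\
       (forall t, simp g t = strand c j b t)) ->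
  exists w, (forall s j m, m \in msupp (w s 0 j) -> P j m) /\ koszul w =1 c.
Proof.
move=> H; have [N cN] := strand_bound c.
have [g0 g0P] := exists_fun2 H.
pose g j b s := if (mdeg b < N)%N then g0 j b s else 0.
have gN j s b' : (N <= mdeg b')%N -> g j b' s = 0 by rewrite /g ltnNge => ->.
have gE j b s : strand (assemble N g) j b s = g j b s.
  case: (boolP (mesym1 s <= b)%MM) => sb; first by apply: strand_assemble => // b'; apply: gN.
  rewrite /strand (negPf sb) /g; case: ifP => // _.
  by apply/esym/eqP; apply: contraTT sb => /(g0P j b).1 [->].
exists (assemble N g); split.
  move=> s j m; rewrite mcoeff_msupp.
  have := gE j (m + mesym1 s)%MM s; rewrite /strand lem_addl addmK => ->.
  rewrite /g; case: ifP => // _; last by rewrite eqxx.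
  by move=> /(g0P _ _).1 []; rewrite addmK.
apply: strand_inj => j b s; rewrite strand_koszul.
transitivity (simp (g j b) s); first by apply: eq_bigr => v _; rewrite gE.
case: (ltnP (mdeg b) N) => Nb; last first.
  by rewrite cN // /kdiff big1 // => v _; rewrite gN // scaler0.
rewrite -(g0P j b).2; apply: eq_bigr => v _.
by rewrite /g Nb.
Qed.

Lemma simp_cone v (f : {set 'I_n} -> K^o) :
  (forall t, simp f t = 0) -> forall t, simp (kcone v f) t = f t.
Proof.
move=> f0 t; have := kdiff_kcone (fun=> 1 : K) v f t; rewrite scale1r => <-.
by rewrite /kcone; case: ifP => _; rewrite ?f0 ?scaler0 addr0.
Qed.

Lemma koszul_free_exact c :
    (forall t, koszul c t = 0) -> (forall j, (c set0 0 j)@_0 = 0) ->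
  exists w, koszul w =1 c.
Proof.
move=> c0 cst; have [|w [_ ?]] := @koszul_lift c (fun _ _ => True); last by exists w.
move=> j b; have f0 t : simp (strand c j b) t = 0.
  rewrite -strand_koszul /strand c0 mxE mcoeff0; by case: ifP.
(* A vertex in the support of [b] is a cone apex: adding it to a face stays within the
   multidegree. *)
have [v bv|b0] := pickP (fun v => b v != 0%N).
  exists (kcone v (strand c j b)); split; last exact: simp_cone.
  move=> s; rewrite /kcone; case: ifP => [vs|]; last by rewrite eqxx.
  rewrite /strand; case: ifP => [sb _|_]; last by rewrite scaler0 eqxx.
  by split=> //; rewrite -(setD1K vs) mesym1_leU ?sb // !inE eqxx.
(* For [b = 0] only the empty face occurs, and its coefficient vanishes by hypothesis. *)
exists (fun=> 0); split=> [s|t]; first by rewrite eqxx.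
rewrite /kdiff big1 => [|v _]; last by rewrite scaler0.
rewrite /strand; case: ifP => // tb.
have bE : b = 0%MM by apply/mnmP=> i; rewrite mnmE; apply/eqP/negbFE/b0.
have -> : t = set0.
  apply/setP=> i; rewrite inE; apply/negP=> it.
  by move/mnm_lepP: tb => /(_ i); rewrite mnmE it bE mnm0E.
by rewrite bE mesym1_set0 subm0 cst.
Qed.

End Coefficients.

End Koszul.

(** * Graded exactness and syzygies *)

Section KoszulExactness.
Variables (K : fieldType) (n : nat).
Local Notation R := {mpoly K[n]}.
Implicit Types (s t : {set 'I_n}) (m : 'X_{1..n}) (p q : R).

Local Notation koszul := (kdiff (fun v : 'I_n => 'X_v : R)).

(** * Homogeneous components and maps of degree 0 *)

Definition homog_part a d p : R :=
  \sum_(m : 'X_{1..n < d.+1}) (if (mdeg m + a == d)%N then p@_m else 0) *: 'X_[m].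

Lemma mcoeff_homog_part a d p m :
  (homog_part a d p)@_m = if (mdeg m + a == d)%N then p@_m else 0.
Proof.
case: (ltnP (mdeg m) d.+1) => md.
  by rewrite (mcoeff_mpoly (fun m => if (mdeg m + a == d)%N then p@_m else 0)).
rewrite raddf_sum big1 /= => [|k _]; first by case: eqP => //; lia.
rewrite mcoeffZ mcoeffX; case: (val k =P m) => [E|_]; last by rewrite mulr0.
by have := bmdeg k; rewrite E; lia.
Qed.

Lemma homog_part_sum (I : finType) (P : pred I) (F : I -> R) a d :
  homog_part a d (\sum_(i | P i) F i) = \sum_(i | P i) homog_part a d (F i).
Proof.
apply/mpolyP=> m; rewrite mcoeff_homog_part !raddf_sum /=.
case: ifPn => md; first by apply: eq_bigr => i _; rewrite mcoeff_homog_part md.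
by rewrite big1 // => i _; rewrite mcoeff_homog_part (negPf md).
Qed.

Lemma homog_partM a a' d p q :
    (forall m, m \in msupp q -> (mdeg m + a')%N = a) ->
  homog_part a' d (p * q) = homog_part a d p * q.
Proof.
move=> qa; apply/mpolyP=> m; rewrite mcoeff_homog_part !mcoeffM.
rewrite -[RHS]mulr1n; case: ifPn => md; rewrite ?mulr1n.
  apply: eq_bigr => -[k1 k2] /= /eqP mE; rewrite mcoeff_homog_part.
  have [|/memN_msupp_eq0->] := boolP (val k2 \in msupp q); last by rewrite !mulr0.
  by move/qa => ka; rewrite -ka addnCA addnA -mdegD addmC -mE md.
rewrite big1 // => -[k1 k2] /= /eqP mE; rewrite mcoeff_homog_part.
have [|/memN_msupp_eq0->] := boolP (val k2 \in msupp q); last by rewrite mulr0.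
by move/qa => ka; rewrite -ka addnCA addnA -mdegD addmC -mE (negPf md) mul0r.
Qed.

Definition vproj r (sh : 'I_r -> nat) d (x : 'rV[R]_r) : 'rV[R]_r :=
  \row_j homog_part (sh j) d (x 0 j).

Definition homogv r (sh : 'I_r -> nat) d (x : 'rV[R]_r) :=
  forall j m, m \in msupp (x 0 j) -> (mdeg m + sh j)%N = d.

Lemma vproj_homog r (sh : 'I_r -> nat) d x : homogv sh d (vproj sh d x).
Proof.
move=> j m; rewrite mcoeff_msupp mxE mcoeff_homog_part.
by case: ifP => [/eqP->|_] //; rewrite eqxx.
Qed.

Lemma homogv0 r (sh : 'I_r -> nat) d : homogv sh d 0.
Proof. by move=> j m; rewrite mxE msupp0. Qed.

Lemma vproj_id r (sh : 'I_r -> nat) d x : homogv sh d x -> vproj sh d x = x.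
Proof.
move=> hx; apply/rowP=> j; apply/mpolyP=> m; rewrite mxE mcoeff_homog_part.
case: eqP => // mj; apply/esym; apply: memN_msupp_eq0.
by apply/negP=> /hx.
Qed.

Definition graded_mx r r' (sh : 'I_r -> nat) (sh' : 'I_r' -> nat) (A : 'M[R]_(r, r')) :=
  forall j k m, m \in msupp (A j k) -> (mdeg m + sh' k)%N = sh j.

Lemma vproj_mulmx r r' (sh : 'I_r -> nat) (sh' : 'I_r' -> nat) A d x :
  graded_mx sh sh' A -> vproj sh' d (x *m A) = vproj sh d x *m A.
Proof.
move=> gA; apply/rowP=> k; rewrite !mxE homog_part_sum; apply: eq_bigr => j _.
by rewrite mxE (homog_partM (a := sh j)) // => m; apply: gA.
Qed.

Definition row_image r r' (A : 'M[R]_(r, r')) (x : 'rV[R]_r') := exists u, x = u *m A.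

Definition row_kernel r r' (A : 'M[R]_(r, r')) (u : 'rV[R]_r) := u *m A = 0.

Lemma koszul_mulmx r r' (A : 'M[R]_(r, r')) (c : {set 'I_n} -> 'rV[R]_r) t :
  koszul (fun s => c s *m A) t = koszul c t *m A.
Proof. by rewrite /kdiff mulmx_suml; apply: eq_bigr => v _; rewrite scalemxAl. Qed.

Section Shifted.
Variables (r : nat) (sh : 'I_r -> nat).
Implicit Types (c : {set 'I_n} -> 'rV[R]_r) (M : 'rV[R]_r -> Prop).

Definition ksh s j : nat := sh j + #|s|.

Definition kproj i d c s : 'rV[R]_r :=
  if #|s| == i then vproj (ksh s) d (c s) else 0.

Definition kchain i d c :=
  (forall s, #|s| != i -> c s = 0) /\ (forall s, homogv (ksh s) d (c s)).

(** No homogeneity is asked of the preimage [w]: for graded [M], [kproj] turns any preimage into one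
    of homological degree [i.+1] and internal degree [d]. *)
Definition koszul_exact M i d :=
  forall c, (forall s, M (c s)) -> kchain i d c -> koszul c =1 (fun=> 0) ->
  exists w, (forall s, M (w s)) /\ koszul w =1 c.

Lemma eq_koszul_exact M M' i d : (forall x, M x <-> M' x) ->
  koszul_exact M i d <-> koszul_exact M' i d.
Proof.
move=> E; split=> H c Mc ci c0.
  have [w [Mw wc]] := H c (fun s => (E _).2 (Mc s)) ci c0.
  by exists w; split=> // s; apply/E.
have [w [Mw wc]] := H c (fun s => (E _).1 (Mc s)) ci c0.
by exists w; split=> // s; apply/E.
Qed.

Lemma kproj_chain i d c : kchain i d (kproj i d c).
Proof.
rewrite /kproj; split=> s; first by case: eqP.
by case: ifP => _; [apply: vproj_homog | apply: homogv0].
Qed.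

Lemma kproj_id i d c : kchain i d c -> kproj i d c =1 c.
Proof.
move=> [ci cd] s; rewrite /kproj; case: ifPn => [_|/ci->//].
exact: vproj_id.
Qed.

Lemma koszul_kproj i d c t : koszul (kproj i.+1 d c) t = kproj i d (koszul c) t.
Proof.
rewrite /kproj; case: ifPn => ti; last first.
  by rewrite /kdiff big1 // => v vt; rewrite cardsU1 vt eqSS (negPf ti) scaler0.
apply/rowP=> j; rewrite mxE /kdiff !summxE homog_part_sum; apply: eq_bigr => v vt.
rewrite cardsU1 vt eqSS ti !mxE [in RHS]mulrC (homog_partM (a := ksh (v |: t) j)) 1?mulrC //.
move=> m; rewrite /ksh cardsU1 vt /ksign -signr_odd => mv.
suff -> : mdeg m = 1%N by lia.
move: mv; case: odd; rewrite ?expr1 ?expr0 ?mulr1 ?mulrN1 ?(perm_mem (msuppN _));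
  by rewrite msuppX inE => /eqP->; rewrite mdeg1.
Qed.

End Shifted.

Lemma kproj_mulmx r r' (sh : 'I_r -> nat) (sh' : 'I_r' -> nat) A i d c s :
    graded_mx sh sh' A ->
  kproj sh' i d (fun s => c s *m A) s = kproj sh i d c s *m A.
Proof.
move=> gA; rewrite /kproj; case: ifP => _; last by rewrite mul0mx.
by apply: vproj_mulmx => j k m /gA E; rewrite /ksh addnA E.
Qed.

Section Syzygies.
Variables (r r' : nat) (sh : 'I_r -> nat) (sh' : 'I_r' -> nat) (A : 'M[R]_(r, r')).
Hypothesis gA : graded_mx sh sh' A.
Hypothesis minA : forall u, row_kernel A u -> forall j, (u 0 j)@_0 = 0.

Lemma lift_chain c i d : (forall s, row_image A (c s)) -> kchain sh' i d c ->
  exists2 c', kchain sh i d c' & forall s, c s = c' s *m A.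
Proof.
move=> Ac ci; have [c1 cE] := exists_fun Ac; exists (kproj sh i d c1).
  exact: kproj_chain.
move=> s; rewrite -(kproj_mulmx _ _ _ _ gA) -[LHS](kproj_id ci).
by rewrite /kproj -cE.
Qed.

(* Dimension shifting along [0 -> ker A -> R^r -> im A -> 0]. *)
Lemma koszul_exact_syzygy i d :
  koszul_exact sh (row_kernel A) i d <-> koszul_exact sh' (row_image A) i.+1 d.
Proof.
split=> ex c Mc ci c0.
  (* The Koszul image of a lift [c'] of [c] lies in [ker A], hence is also the image of some [u]
     with values in [ker A]. *)
  have [c' c'i cE] := lift_chain Mc ci.
  have [|||u [Au uE]] := ex (koszul c').
  - by move=> s; rewrite /row_kernel -koszul_mulmx -(eq_kdiff _ cE).
  - have E := eq_kdiff (fun v : 'I_n => 'X_v : R) (kproj_id c'i).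
    have [Ki Kd] := kproj_chain sh i d (koszul c').
    by split=> s; rewrite -E koszul_kproj; [apply: Ki | apply: Kd].
  - exact: kdiffK.
  (* Now [c' - u] is a cycle of the free module without constant terms at the empty face, so it is
     the image of some [w], and [w *m A] is the required preimage. *)
  have [||w wE] := @koszul_free_exact K n r (fun s => c' s - u s).
  - by move=> t; rewrite kdiffB uE subrr.
  - move=> j; rewrite c'i.1 ?cards0 // sub0r mxE mcoeffN (minA (Au _)) //.
    by rewrite oppr0.
  exists (fun s => w s *m A); split=> [s|s]; first by exists (w s).
  by rewrite koszul_mulmx wE mulmxBl -cE Au subr0.
(* Conversely, a cycle [c] in [ker A] bounds some [w] in the free module, and subtracting a boundary
   from [w] moves it into [ker A]. *)
have [||w0 w0E] := @koszul_free_exact K n r c => //; first by move=> j; apply: minA.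
pose w := kproj sh i.+1 d w0.
have wE : koszul w =1 c.
  by move=> t; rewrite koszul_kproj -[RHS](kproj_id ci) /kproj w0E.
have [|||u [Au uE]] := ex (fun s => w s *m A).
- by move=> s; exists (w s).
- have [Ki Kd] := kproj_chain sh' i.+1 d (fun s => w0 s *m A).
  by split=> s; rewrite -(kproj_mulmx _ _ _ _ gA); [apply: Ki | apply: Kd].
- by move=> t; rewrite koszul_mulmx wE Mc.
have [u' u'E] := exists_fun Au.
exists (fun s => w s - koszul u' s); split=> s.
  by rewrite /row_kernel mulmxBl -koszul_mulmx -(eq_kdiff _ u'E) uE subrr.
by rewrite kdiffB kdiffK subr0.
Qed.

(** If generator [j] of degree [d], placed on the empty face, were a boundary, there would be a
    syzygy with constant term 1 at [j], against [minA]. Without generators of degree [d], a lifted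
    chain has no constant terms and bounds in the free module. *)
Lemma koszul_exact_generators d :
  koszul_exact sh' (row_image A) 0 d <-> forall j, sh j <> d.
Proof.
split=> [ex j jd|nod].
  pose c s := if s == set0 then row j A else 0.
  have cA s : row_image A (c s).
    rewrite /c; case: ifP => _; first by exists (delta_mx 0 j); rewrite -rowE.
    by exists 0; rewrite mul0mx.
  have [|t|w [Aw wE]] := ex c cA.
  - split=> s; first by rewrite /c cards_eq0 => /negPf->.
    rewrite /c; case: eqP => [->|_]; last exact: homogv0.
    by move=> k m; rewrite mxE /ksh cards0 addn0 => /gA ->.
  - rewrite /kdiff big1 // => v _; rewrite /c; case: eqP => [E|_]; last by rewrite scaler0.
    by have := setU11 v t; rewrite E inE.
  have [u uE] := exists_fun Aw.
  have/minA/(_ j) : row_kernel A (delta_mx 0 j - koszul u set0).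
    rewrite /row_kernel mulmxBl -rowE -koszul_mulmx -(eq_kdiff _ uE) wE.
    by rewrite /c eqxx subrr.
  rewrite !mxE !eqxx mcoeffB mcoeff1 eqxx /kdiff summxE raddf_sum big1 ?subr0 /=.
    by move/eqP; rewrite oner_eq0.
  move=> v _; rewrite mxE mulrAC mulrC mcoeffXM mnm0E eqxx //.
move=> c Ac ci c0; have [c' c'i cE] := lift_chain Ac ci.
have [||w wE] := @koszul_free_exact K n r c'.
- move=> t; rewrite /kdiff big1 // => v vt.
  by rewrite c'i.1 ?scaler0 // cardsU1 vt.
- move=> j; apply: memN_msupp_eq0; apply/negP=> /c'i.2.
  by rewrite mdeg0 /ksh cards0 addn0 => /nod.
exists (fun s => w s *m A); split=> s; first by exists (w s).
by rewrite koszul_mulmx wE cE.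
Qed.

End Syzygies.

End KoszulExactness.

(** A subspace inside [P] either exhausts it or can be enlarged by a vector; the ambient dimension
    bounds the enlargements. *)
Lemma pred_vspace (K : fieldType) (V : vectType K) (P : V -> Prop) :
    P 0 -> (forall a x y, P x -> P y -> P (a *: x + y)) ->
  exists U : {vspace V}, forall v, v \in U <-> P v.
Proof.
move=> P0 PD.
have main k : (exists U : {vspace V}, forall v, v \in U <-> P v) \/
    exists2 U : {vspace V}, (forall v, v \in U -> P v) & (k <= \dim U)%N.
  elim: k => [|k [|[U UP Uk]]]; [|by left|].
    by right; exists 0%VS => // v; rewrite memv0 => /eqP->.
  case: (classic (exists2 v, P v & v \notin U)) => [[v Pv vU]|nv]; last first.
    left; exists U => v; split; first exact: UP.
    by move=> Pv; apply/negPn/negP=> vU; apply: nv; exists v.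
  right; exists (<[v]> + U)%VS.
    by move=> _ /memv_addP[_ /vlineP[a ->] [u uU ->]]; apply: PD => //; apply: UP.
  apply: leq_ltn_trans Uk _.
  rewrite (ltn_leqif (dimv_leqif_sup (addvSr _ _))) subv_add subvv andbT.
  by rewrite -memvE.
case: (main (\dim {:V}).+1) => // -[U _].
by rewrite ltnNge dimvS ?subvf.
Qed.

(** * Minimal resolutions *)

Section MinimalResolution.
Variables (K : fieldType) (n : nat).
Local Notation R := {mpoly K[n]}.
Local Notation koszul := (kdiff (fun v : 'I_n => 'X_v : R)).

Definition submod r (M : 'rV[R]_r -> Prop) :=
  M 0 /\ forall a x y, M x -> M y -> M (a *: x + y).

Definition graded_submod r (sh : 'I_r -> nat) (M : 'rV[R]_r -> Prop) :=
  submod M /\ forall d x, M x -> M (vproj sh d x).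

Lemma submod_sum r (M : 'rV[R]_r -> Prop) (I : finType) (P : pred I) a x :
  submod M -> (forall i, P i -> M (x i)) -> M (\sum_(i | P i) a i *: x i).
Proof.
move=> [M0 MD] Mx; elim/big_rec: _ => // i y Pi My; apply: MD => //; exact: Mx.
Qed.

Lemma row_image_submod r r' (A : 'M[R]_(r, r')) : submod (row_image A).
Proof.
split; first by exists 0; rewrite mul0mx.
by move=> a _ _ [u ->] [v ->]; exists (a *: u + v); rewrite mulmxDl scalemxAl.
Qed.

Lemma row_kernel_graded r r' (sh : 'I_r -> nat) (sh' : 'I_r' -> nat) (A : 'M[R]_(r, r')) :
  graded_mx sh sh' A -> graded_submod sh (row_kernel A).
Proof.
move=> gA; rewrite /row_kernel; split; first split; first by rewrite mul0mx.
  by move=> a x y xA yA; rewrite mulmxDl -scalemxAl xA yA scaler0 addr0.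
move=> d x xA; rewrite -(vproj_mulmx _ _ gA) xA.
by rewrite vproj_id //; apply: homogv0.
Qed.

Lemma vproj_ksh r (sh : 'I_r -> nat) d (s : {set 'I_n}) (x : 'rV[R]_r) :
  (#|s| <= d)%N -> vproj (ksh sh s) d x = vproj sh (d - #|s|) x.
Proof.
move=> sd; apply/rowP=> j; apply/mpolyP=> m; rewrite !mxE !mcoeff_homog_part /ksh.
by congr (if _ then _ else _); apply/eqP/eqP; lia.
Qed.

Lemma vproj_sum r (sh : 'I_r -> nat) (x : 'rV[R]_r) :
  exists B, x = \sum_(e < B) vproj sh e x.
Proof.
exists (\max_j (msize (x 0%R j) + sh j)).+1.
apply/rowP=> j; apply/mpolyP=> m; rewrite summxE raddf_sum /=.
under eq_bigr do rewrite mxE mcoeff_homog_part.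
have [mx|/memN_msupp_eq0->] := boolP (m \in msupp (x 0 j)); last first.
  by rewrite big1 // => e _; case: ifP.
have lt : (mdeg m + sh j < (\max_j (msize (x 0%R j) + sh j)).+1)%N.
  rewrite ltnS; apply: leq_trans (leq_bigmax j).
  by rewrite leq_add2r ltnW // msize_mdeg_lt.
rewrite (bigD1 (Ordinal lt)) //= eqxx big1 ?addr0 // => e.
by rewrite -val_eqE /= eq_sym => /negPf->.
Qed.

(** Above degree [N], exactness in homological degree 0 puts homogeneous elements into
    [(x_1, ..., x_n) M] and so reduces them to lower degree. Up to degree [N] everything lies in a
    finite-dimensional space, whose basis supplies the generators. *)
Lemma graded_submod_fin_gen r (sh : 'I_r -> nat) M N :
    graded_submod sh M -> (forall d, (N < d)%N -> koszul_exact sh M 0 d) ->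
  exists l (sh2 : 'I_l -> nat) (A : 'M[R]_(l, r)),
    graded_mx sh2 sh A /\ forall x, M x <-> row_image A x.
Proof.
move=> [Msub Mproj] ex.
pose V := {ffun 'I_r * 'X_{1..n < N.+1} -> K^o}.
(* Shifts are natural numbers, so monomials of degree at most [N] suffice for internal degree at
   most [N]. *)
pose dec (y : V) : 'rV[R]_r := \row_j \sum_b (y (j, b) : K) *: 'X_[bmnm b].
have dec_lin a (x y : V) : dec (a *: x + y) = a%:MP *: dec x + dec y.
  apply/rowP=> j; rewrite !mxE mul_mpolyC scaler_sumr -big_split /=.
  by apply: eq_bigr => b _; rewrite !ffunE scalerDl scalerA.
have dec0 : dec 0 = 0.
  by apply/rowP=> j; rewrite !mxE big1 // => b _; rewrite ffunE scale0r.
have [U UP] : exists U : {vspace V}, forall v, v \in U <-> M (dec v).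
  apply: pred_vspace; first by rewrite dec0; exact: Msub.1.
  by move=> a x y Mx My; rewrite dec_lin; apply: Msub.2.
(* The generators are the components, in degrees 0 to [N], of the decoded basis of [U]. *)
pose I := ('I_(\dim U) * 'I_N.+1)%type.
pose G (p : I) : 'rV[R]_r := vproj sh p.2 (dec (vbasis U)`_p.1).
pose A := \matrix_(k < #|{: I}|) G (enum_val k).
have MG p : M (G p).
  by apply/Mproj/UP/vbasis_mem/mem_nth; rewrite size_tuple.
have AG p : row_image A (G p).
  by exists (delta_mx 0 (enum_rank p)); rewrite -rowE rowK enum_rankK.
exists #|{: I}|, (fun k => nat_of_ord (enum_val k).2), A; split.
  move=> k j m; rewrite mxE; exact: vproj_homog.
move=> x; split; last first.
  move=> [u ->]; rewrite mulmx_sum_row; apply: submod_sum => // k _.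
  by rewrite rowK.
have homog_gen e : forall y, M y -> homogv sh e y -> row_image A y.
  elim/ltn_ind: e => e IH y My ye; case: (leqP e N) => eN.
    pose z : V := [ffun p => (y 0 p.1)@_(bmnm p.2)].
    have yz : y = dec z.
      apply/rowP=> j; rewrite mxE; under eq_bigr do rewrite ffunE /=.
      apply/mpolyP=> m; case: (ltnP (mdeg m) N.+1) => mN.
        by rewrite (mcoeff_mpoly (fun m => (y 0 j)@_m)).
      rewrite memN_msupp_eq0; last by apply/negP=> /ye; lia.
      rewrite raddf_sum big1 //= => b _; rewrite mcoeffZ mcoeffX.
      case: (bmnm b =P m) => [E|]; last by rewrite mulr0.
      by have := bmdeg b; rewrite E; lia.
    have /coord_vbasis zE : z \in U by apply/UP; rewrite -yz.
    have decS (J : finType) (a : J -> K) (f : J -> V) :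
        dec (\sum_i a i *: f i) = \sum_i (a i)%:MP *: dec (f i).
      by elim/big_rec2: _ => [|i y1 y2 _ <-]; rewrite ?dec0 ?dec_lin.
    have -> : y = \sum_i (coord (vbasis U) i z)%:MP *: G (i, inord e).
      rewrite -(vproj_id ye) {1}yz {1}zE decS; apply/rowP=> j.
      rewrite mxE !summxE homog_part_sum; apply: eq_bigr => i _.
      rewrite !mxE inordK ?ltnS // [in LHS]mulrC [in RHS]mulrC.
      rewrite (homog_partM (a := sh j)) // => m.
      by rewrite msuppC; case: eqP => // _; rewrite inE => /eqP->; rewrite mdeg0.
    by apply: submod_sum => [|i _]; [apply: row_image_submod | apply: AG].
  (* For [e > N], [y] on the empty face is a cycle, so [y = \sum_v 'X_v w_v], where [w_v] can be cut
     down to degree [e - 1]. *)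
  pose c (s : {set 'I_n}) := if s == set0 then y else 0.
  have c_chain : kchain sh 0 e c.
    split=> s; first by rewrite /c cards_eq0 => /negPf->.
    rewrite /c; case: eqP => [->|_]; last exact: homogv0.
    by move=> j m /ye; rewrite /ksh cards0 addn0.
  have [||t|w [Mw wE]] := ex e eN c => //.
  - by move=> s; rewrite /c; case: ifP => // _; apply: Msub.1.
  - rewrite /kdiff big1 // => v _; rewrite /c; case: eqP => [E|_].
      by have := setU11 v t; rewrite E inE.
    by rewrite scaler0.
  have := koszul_kproj sh 0 e w set0.
  have -> : kproj sh 0 e (koszul w) set0 = y.
    have <- : c set0 = y by rewrite /c eqxx.
    by rewrite -[RHS](kproj_id c_chain) /kproj wE.
  move=> <-; apply: submod_sum => [|v _]; first exact: row_image_submod.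
  rewrite setU0 /kproj cards1 eqxx vproj_ksh cards1; last by lia.
  apply: (IH (e - 1)%N); [by lia | exact: Mproj | exact: vproj_homog].
move=> Mx; have [B ->] := vproj_sum sh x.
under eq_bigr do rewrite -[vproj _ _ _]scale1r.
apply: submod_sum => [|e _]; first exact: row_image_submod.
by apply: (homog_gen e); [apply: Mproj | apply: vproj_homog].
Qed.

(* A syzygy with a unit coefficient makes one generator redundant. *)
Lemma minimize_generators r (sh : 'I_r -> nat) l (sh1 : 'I_l -> nat) (A : 'M[R]_(l, r)) :
    graded_mx sh1 sh A ->
  exists l' (sh2 : 'I_l' -> nat) (B : 'M[R]_(l', r)),
    [/\ graded_mx sh2 sh B, forall x, row_image A x <-> row_image B x
      & forall u, row_kernel B u -> forall j, (u 0 j)@_0 = 0].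
Proof.
elim: l sh1 A => [|l IH] sh1 A gA.
  by exists 0%N, sh1, A; split=> // u _ [].
case: (classic (exists2 u, row_kernel A u & exists j, (u 0 j)@_0 != 0)); last first.
  move=> nu; exists l.+1, sh1, A; split=> // u uA j; apply/eqP/negPn/negP=> uj.
  by apply: nu; exists u => //; exists j.
move=> [u0 u0A [j]]; set a := (u0 0 j)@_0 => a0.
(* Taking the component in the degree of generator [j] leaves the invertible constant [a] as
   coefficient at [j]. *)
pose u := vproj sh1 (sh1 j) u0.
have uA : u *m A = 0 by apply: (row_kernel_graded gA).2.
have uj : u 0 j = a%:MP.
  apply/mpolyP=> m; rewrite mxE mcoeff_homog_part mcoeffC -[X in _ == X]add0n eqn_add2r mdeg_eq0.
  by case: eqP => [->|_]; rewrite ?mulr1 ?mulr0.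
clearbody u.
have gB : graded_mx (fun i => sh1 (lift j i)) sh (row' j A).
  by move=> i k m; rewrite mxE; apply: gA.
have [l' [sh2 [B [gB' BE minB]]]] := IH _ _ gB.
exists l', sh2, B; split=> // x; rewrite -BE; split=> -[y ->].
  (* Subtracting a multiple of the syzygy [u] clears the coordinate at [j] without changing the
     image. *)
  pose y' := y - (a^-1%:MP * y 0 j) *: u.
  have y'j : y' 0 j = 0.
    by rewrite !mxE uj mulrAC -mpolyCM mulVf // mul1r subrr.
  have -> : y *m A = y' *m A by rewrite mulmxBl -scalemxAl uA scaler0 subr0.
  exists (col' j y'); apply/rowP=> k; rewrite !mxE (bigD1_ord j) //= y'j mul0r add0r.
  by apply: eq_bigr => i _; congr (_ * _); rewrite [RHS]mxE.
exists (y *m row' j 1%:M); rewrite -mulmxA; congr (_ *m _).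
by apply/matrixP=> i k; rewrite -[A in LHS]mul1mx !mxE; apply: eq_bigr => i' _; rewrite !mxE.
Qed.

(** * Resolutions by iterated minimal covers *)

Record stage := Stage {
  st_rank : nat;
  st_shift : 'I_st_rank -> nat;
  st_mod : 'rV[R]_st_rank -> Prop
}.

Record cover (S : stage) := Cover {
  cv_rank : nat;
  cv_shift : 'I_cv_rank -> nat;
  cv_mx : 'M[R]_(cv_rank, st_rank S)
}.

Definition minimal_cover S (C : cover S) :=
  [/\ graded_mx (@cv_shift S C) (@st_shift S) (cv_mx C),
      forall x, st_mod x <-> row_image (cv_mx C) x
    & forall u, row_kernel (cv_mx C) u -> forall j, (u 0 j)@_0 = 0].

(** Exactness is required in every homological degree [i], because each passage to syzygies lowers
    [i] by one. *)
Definition good_stage N S :=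
  graded_submod (@st_shift S) (@st_mod S) /\
  forall i d, (N < d)%N -> koszul_exact (@st_shift S) (@st_mod S) i d.

Definition pick_cover S : cover S :=
  epsilon (inhabits (@Cover S 0 (fun=> 0%N) 0)) (@minimal_cover S).

Definition next_stage S : stage :=
  Stage (@cv_shift S (pick_cover S)) (row_kernel (cv_mx (pick_cover S))).

Lemma pick_coverP N S : good_stage N S -> minimal_cover (pick_cover S).
Proof.
move=> [gS ex]; apply: epsilon_spec.
have [l [sh1 [A [gA AE]]]] := graded_submod_fin_gen gS (ex 0%N).
have [l' [sh2 [B [gB BE minB]]]] := minimize_generators gA.
by exists (Cover sh2 B); split=> // x; rewrite AE BE.
Qed.

Lemma next_stage_good N S : good_stage N S -> good_stage N (next_stage S).
Proof.
move=> gS; have [gA AE minA] := pick_coverP gS; split.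
  exact: row_kernel_graded gA.
move=> i d Nd; apply/(koszul_exact_syzygy gA minA).
by apply/(eq_koszul_exact _ _ _ AE)/gS.2.
Qed.

Definition ideal_row (I : R -> Prop) (x : 'rV[R]_1) := I (x 0 0).

Lemma minimal_resolution_exists (I : R -> Prop) N :
    graded_submod (fun=> 0%N) (ideal_row I) ->
    (forall i d, (N < d)%N -> koszul_exact (fun=> 0%N) (ideal_row I) i d) ->
  exists F, minimal_graded_free_resolution I F.
Proof.
move=> gI exI; pose S0 := @Stage 1 (fun=> 0%N) (ideal_row I).
pose St i := iter i next_stage S0.
have good i : good_stage N (St i) by elim: i => [|i]; [split | apply: next_stage_good].
have cov i := pick_coverP (good i).
(* [St 0] is the ideal inside [R], so [F_i] is the ambient module of [St i.+1]. *)
pose F := @FreeComplex K n (fun i => st_rank (St i.+1)) (fun i => @st_shift (St i.+1))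
  (cv_mx (pick_cover S0)) (fun i => cv_mx (pick_cover (St i.+1))).
have ker_im i (v : 'rV_(res_rank F i)) :
    v *m cv_mx (pick_cover (St i)) = 0 <-> exists w, v = w *m res_diff F i.
  by have [_ + _] := cov i.+1; apply.
exists F; split; [split|split|].
- move=> j; apply/dhomogP=> m mA; have [gA _ _] := cov 0%N.
  by have := gA j 0 m mA; rewrite addn0.
- by move=> i j k m mA; have [gA _ _] := cov i.+1; apply: gA.
- move=> p; have [_ AE _] := cov 0%N.
  have := AE (\row_j p); rewrite {1}/St /= /ideal_row mxE => ->.
  split=> -[v]; [move/rowP/(_ 0); rewrite mxE => ->; exists v => // |].
  move=> pE; exists v; apply/rowP=> j; by rewrite mxE pE ord1.
- exact: ker_im 0%N.
- by move=> i v; apply: (ker_im i.+1).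
- move=> i j k; have [_ _ minA] := cov i.
  (* A row of the differential is a syzygy of the preceding cover, hence has no constant terms. *)
  have -> : res_diff F i j k = row j (res_diff F i) 0 k by rewrite mxE.
  by apply: minA; apply/ker_im; exists (delta_mx 0 j); rewrite -rowE.
Qed.

Lemma resolution_betti_neq0 (I : R -> Prop) F i d :
    minimal_graded_free_resolution I F ->
  resolution_betti F i d <> 0%N <-> ~ koszul_exact (fun=> 0%N) (ideal_row I) i d.
Proof.
move=> [[gaug gdiff] [Iaug augker diffker] minF].
have gA0 : graded_mx (@res_shift _ _ F 0) (fun=> 0%N) (res_aug F).
  move=> j k m; rewrite ord1 addn0 => mA; by move/dhomogP: (gaug j); apply.
have gA i' : graded_mx (@res_shift _ _ F i'.+1) (@res_shift _ _ F i') (res_diff F i').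
  by move=> j k m; apply: gdiff.
have min_im i' u : row_image (res_diff F i') u -> forall j, (u 0 j)@_0 = 0.
  move=> [w ->] j; rewrite mxE raddf_sum big1 //= => k _.
  by rewrite rmorphM /= minF mulr0.
have min0 u : row_kernel (res_aug F) u -> forall j, (u 0 j)@_0 = 0.
  by move=> /augker; apply: min_im.
have minS i' u : row_kernel (res_diff F i') u -> forall j, (u 0 j)@_0 = 0.
  by move=> /diffker; apply: min_im.
have IE x : ideal_row I x <-> row_image (res_aug F) x.
  rewrite /ideal_row Iaug; split=> -[v E]; exists v; last by rewrite E.
  by apply/rowP=> j; rewrite ord1.
(* Each image is the kernel of the preceding map, so [k.+1] dimension shifts lead back to the
   ideal. *)
have shift_im k i' : koszul_exact (@res_shift _ _ F k) (row_image (res_diff F k)) i' d <->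
    koszul_exact (fun=> 0%N) (ideal_row I) (i' + k.+1)%N d.
  elim: k i' => [|k IH] i'.
    rewrite addn1 (eq_koszul_exact _ _ _ IE) -(koszul_exact_syzygy gA0 min0).
    apply: eq_koszul_exact => x; exact: iff_sym (augker x).
  rewrite -addSnnS -IH -(koszul_exact_syzygy (gA k) (@minS k)).
  apply: eq_koszul_exact => x; exact: iff_sym (diffker _ x).
have -> : koszul_exact (fun=> 0%N) (ideal_row I) i d <->
    forall j : 'I_(res_rank F i), res_shift j <> d.
  case: i => [|i].
    by rewrite (eq_koszul_exact _ _ _ IE); apply: koszul_exact_generators.
  by rewrite -(koszul_exact_generators (gA i) (@minS i)) shift_im.
split=> [bn0 H|H b0].
  apply: bn0; apply/eqP; rewrite cards_eq0; apply/eqP/setP=> j; rewrite !inE.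
  by apply/eqP/H.
apply: H => j jd; move/eqP: b0; rewrite cards_eq0 => /eqP/setP/(_ j).
by rewrite !inE jd eqxx.
Qed.

End MinimalResolution.

(** * The Stanley-Reisner ideal *)

Section StanleyReisnerStrands.
Variables (K : fieldType) (n : nat) (D : {set {set 'I_n}}).
Hypothesis hD : simplicial_complex D.
Local Notation R := {mpoly K[n]}.
Local Notation koszul := (kdiff (fun v : 'I_n => 'X_v : R)).
Local Notation simp := (@kdiff K K^o n (fun _ => 1)).
Local Notation I := (stanley_reisner_ideal K (alexander_dual D)).
Implicit Types (s t : {set 'I_n}) (b m : 'X_{1..n}).

Definition mnm_supp m : {set 'I_n} := [set v | m v != 0%N].

Lemma face_monomialE s : face_monomial K s = 'X_[mesym1 s].
Proof.
rewrite /face_monomial mprodXE; congr 'X_[_].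
apply/mnmP=> v; rewrite mnm_sumE !mnmE; case: (boolP (v \in s)) => vs.
  by rewrite (bigD1 v) //= mnm1E eqxx big1 // => u /andP[_ /negPf]; rewrite mnm1E => ->.
by rewrite big1 // => u us; rewrite mnm1E; case: eqP us vs => // ->->.
Qed.

(** A monomial lies in this monomial ideal iff it is divisible by [face_monomial s] for some [s]
    with [~: s] in [D]; as [D] is closed under subsets, its support can then serve as [s]. *)
Lemma stanley_reisnerP (p : R) : I p <-> forall m, m \in msupp p -> ~: mnm_supp m \in D.
Proof.
split=> [[c ->] m|Ip].
  rewrite mcoeff_msupp raddf_sum /=; apply: contraR => mD; apply/eqP.
  rewrite big1 // => s; rewrite notin_alexander_dual => sD.
  apply: memN_msupp_eq0; rewrite face_monomialE (perm_mem (msuppMX _ _)).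
  apply: contra mD => /mapP[m' _ ->]; apply: hD sD _; rewrite setCS.
  by apply/subsetP=> v vs; rewrite inE mnmDE mnmE vs.
(* The monomials of [p] are grouped by support; each is divisible by the face monomial of its
   support. *)
exists (fun s => \sum_(m <- msupp p | mnm_supp m == s) p@_m *: 'X_[m - mesym1 s]).
rewrite {1}[p]mpolyE big_seq_cond.
rewrite (partition_big mnm_supp (fun s => s \notin alexander_dual D)) /=; last first.
  by move=> m /andP[/Ip mD _]; rewrite notin_alexander_dual.
apply: eq_bigr => s _; rewrite face_monomialE mulr_suml [RHS]big_seq_cond.
apply: eq_big => [m|m /andP[_ /eqP <-]]; first by rewrite andbT.
rewrite -scalerAl -mpolyXD submK //; apply/mnm_lepP=> v.
by rewrite !mnmE inE; case: (m v).
Qed.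

Lemma stanley_reisner_graded : graded_submod (fun=> 0%N) (ideal_row I).
Proof.
split; first split.
- by apply/stanley_reisnerP=> m; rewrite mxE msupp0.
- move=> a x y /stanley_reisnerP Ix /stanley_reisnerP Iy; apply/stanley_reisnerP=> m.
  rewrite !mxE => /msuppD_le; rewrite mem_cat => /orP[|/Iy //].
  move=> /msuppM_le /allpairsP[[m1 m2] /= [_ /Ix m2D ->]].
  apply: hD m2D _; rewrite setCS; apply/subsetP=> v; rewrite !inE mnmDE.
  by apply: contra; rewrite addn_eq0 => /andP[].
- move=> d x /stanley_reisnerP Ix; apply/stanley_reisnerP=> m.
  rewrite mcoeff_msupp mxE mcoeff_homog_part; case: ifP; last by rewrite eqxx.
  by rewrite -mcoeff_msupp => _ /Ix.
Qed.

(* The upper Koszul simplicial complex of [I] in degree [b]: the faces [s] with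
   [x^(b-s)] in [I]. *)
Definition upper_koszul b : {set {set 'I_n}} :=
  [set s | (mesym1 s <= b)%MM && (~: mnm_supp (b - mesym1 s) \in D)].

Definition simp_exact (E : {set {set 'I_n}}) (i : nat) :=
  forall f : {set 'I_n} -> K^o, (forall s, f s != 0 -> s \in E /\ #|s| = i) ->
    simp f =1 (fun=> 0) ->
  exists g : {set 'I_n} -> K^o, (forall s, g s != 0 -> s \in E) /\ simp g =1 f.

Lemma strandE r (c : {set 'I_n} -> 'rV[R]_r) j s m :
  (c s 0 j)@_m = strand c j (m + mesym1 s) s.
Proof. by rewrite /strand lem_addl addmK. Qed.

Lemma koszul_exact_upper (i d : nat) :
  koszul_exact (fun=> 0%N) (ideal_row I) i d <->
  forall b, mdeg b = d -> simp_exact (upper_koszul b) i.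
Proof.
split=> [ex b bd f fE f0|ex c Ic [ci cd] c0].
  (* The simplicial cycle becomes a Koszul chain in the single multidegree [b]; the cutoff [d.+1]
     exceeds [mdeg b]. *)
  pose c := @assemble K n 1 d.+1 (fun _ b' s => if b' == b then f s else 0).
  have cE j b' s : strand c j b' s = if b' == b then f s else 0.
    case: (boolP (mesym1 s <= b')%MM) => sb.
      by rewrite strand_assemble // => b2; case: eqP => // -> ; lia.
    rewrite /strand (negPf sb); case: eqP => // bE; apply/esym/eqP.
    by apply: contraR sb => /fE[]; rewrite inE -bE => /andP[].
  have cS s j m : m \in msupp (c s 0 j) -> f s != 0 /\ (m + mesym1 s)%MM = b.
    by rewrite mcoeff_msupp strandE cE; case: ifP => [/eqP|_]; rewrite ?eqxx.
  have [|||w [Iw wE]] := ex c.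
  - move=> s; apply/stanley_reisnerP=> m /cS[/fE[sb _] mE].
    by move: sb; rewrite inE -mE addmK => /andP[].
  - split=> s => [si|j m /cS[_ mE]]; last by rewrite -bd -mE mdegD mdeg_mesym1.
    apply/rowP=> j; rewrite [RHS]mxE; apply/eqP; rewrite -msupp_eq0.
    case E: (msupp _) => [//|m l]; have [|/fE[_ /eqP]] := cS s j m.
      by rewrite E inE eqxx.
    by rewrite (negPf si).
  - apply: strand_inj => j b' s; rewrite strand_koszul.
    rewrite (eq_kdiff _ (cE j b')) /strand mxE mcoeff0 if_same.
    by case: eqP => _; [apply: f0 | apply: kdiff0].
  exists (strand w 0 b); split=> [s|t]; last first.
    by rewrite -strand_koszul /strand wE -/(strand c 0 b t) cE eqxx.
  rewrite /strand inE; case: ifP => _; last by rewrite eqxx.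
  by rewrite -mcoeff_msupp; apply: (stanley_reisnerP _).1 (Iw s) _.
(* Membership in the ideal is a condition on monomials, so strands can be treated separately. *)
have [j b|w [Iw wE]] := @koszul_lift K n 1 c (fun _ m => ~: mnm_supp m \in D); last first.
  by exists w; split=> // s; apply/stanley_reisnerP=> m; apply: Iw.
rewrite (ord1 j) => {j}.
have cS s : strand c 0 b s != 0 -> [/\ (mesym1 s <= b)%MM, #|s| = i, mdeg b = d
    & ~: mnm_supp (b - mesym1 s) \in D].
  rewrite /strand; case: ifPn => [sb bs|_]; last by rewrite eqxx.
  split=> //.
  - by apply/eqP; apply: contraNT bs => /ci->; rewrite mxE mcoeff0.
  - by rewrite -(cd s 0 (b - mesym1 s)%MM) ?mcoeff_msupp // /ksh add0n mdeg_sub_mesym1.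
  - by apply: (stanley_reisnerP _).1 (Ic s) _ _; rewrite mcoeff_msupp.
case: (eqVneq (mdeg b) d) => bd; last first.
  exists (fun=> 0); split=> [s|t]; rewrite ?eqxx // kdiff0; apply/esym/eqP.
  by apply: contraNT bd => /cS[_ _ ->].
have [s /cS[sb si _ sD]|t|g [gE g0]] := ex b bd (strand c 0 b).
- by rewrite inE sb.
- by rewrite -strand_koszul /strand c0 mxE mcoeff0 if_same.
by exists g; split=> // s /gE; rewrite inE => /andP[].
Qed.

(** The exponent of [v] stays positive, so adding [v] to a face leaves the support of the remaining
    monomial unchanged: [v] is a cone apex. *)
Lemma upper_koszul_cone b v i : (1 < b v)%N -> simp_exact (upper_koszul b) i.
Proof.
move=> bv f fE f0; exists (kcone v f); split; last exact: simp_cone.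
move=> s; rewrite /kcone; case: ifPn => [vs|]; last by rewrite eqxx.
rewrite scaler_eq0 negb_or => /andP[_ /fE[]]; rewrite !inE => /andP[sb sD] _.
have vsv : v \notin s :\ v by rewrite !inE eqxx.
rewrite -{1}(setD1K vs) mesym1_leU // sb -lt0n ltnW //=.
suff -> : mnm_supp (b - mesym1 s) = mnm_supp (b - mesym1 (s :\ v)) by [].
apply/setP=> u; rewrite !inE !mnmBE !mnmE !inE.
by case: (u =P v) => [->|//]; rewrite vs; lia.
Qed.

(** The monomial of [t] divides that of [~: s] iff [t] avoids [s], and the quotient then has support
    [~: (s :|: t)]. *)
Lemma upper_koszul_link s : upper_koszul (mesym1 (~: s)) = link D s.
Proof.
apply/setP=> t; rewrite !inE [s :&: t]setIC.
have -> : (mesym1 t <= mesym1 (~: s))%MM = (t :&: s == set0).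
  rewrite setI_eq0 disjoints_subset; apply/mnm_lepP/subsetP => ts v.
    by move=> vt; have := ts v; rewrite !mnmE vt; case: (v \in _).
  by rewrite !mnmE; case: (boolP (v \in t)) => // /ts ->.
have -> : ~: mnm_supp (mesym1 (~: s) - mesym1 t) = s :|: t.
  apply/setP=> v; rewrite !inE mnmBE !mnmE !inE.
  by case: (v \in s); case: (v \in t).
rewrite andbC; case: (boolP (s :|: t \in D)) => stD; rewrite ?andbF //.
by rewrite (hD stD (subsetUr _ _)).
Qed.

(** * Simplicial chains and reduced homology *)

Lemma mem_chains E k (c : chain K n) :
  c \in chains K E k <-> forall s, c s != 0 -> s \in E /\ #|s|%:Z = k + 1.
Proof.
rewrite /chains; set X := [seq _ | s <- _ & _]; split=> [cX s|cE].
  rewrite (coord_span (X := in_tuple X) cX) sum_ffunE => cs.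
  have [l Xl] : exists l, X`_l s != 0 /\ (l < size X)%N.
    apply: NNPP => nX; case/eqP: cs; rewrite big1 // => l _.
    rewrite ffunE; have [-> |Xl] := eqVneq (X`_l s) 0; first exact: scaler0.
    by case: nX; exists l.
  have : X`_l \in X by apply: mem_nth; case: Xl.
  move=> /mapP[s0]; rewrite mem_filter mem_enum => /andP[/eqP sk sE] XE.
  case: Xl; rewrite XE => + _.
  by rewrite ffunE; case: (s =P s0) => [->|_]; rewrite ?eqxx.
have -> : c = \sum_(s | c s != 0) (c s : K) *: elementary_chain K s.
  apply/ffunP=> t; rewrite sum_ffunE; have [t0|t0] := eqVneq (c t) 0.
    rewrite t0 big1 // => s; rewrite !ffunE; case: (t =P s) => [<-|_ _].
      by rewrite t0 eqxx.
    by rewrite scaler0.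
  rewrite (bigD1 t) //= big1 ?addr0 => [|s /andP[_ st]]; rewrite !ffunE.
    by rewrite eqxx; apply/esym/mulr1.
  by rewrite eq_sym (negPf st) scaler0.
apply: memv_suml => s /cE[sE sk]; apply/memvZ/memv_span/map_f.
by rewrite mem_filter mem_enum sE sk eqxx.
Qed.

(** The boundary is summed again by target face [t]; the sign may be computed in [t] instead of
    [v |: t], since [v] is not below itself. *)
Lemma boundaryE (c : chain K n) : boundary K n c =1 simp c.
Proof.
move=> t; rewrite lfunE /= /boundary_fun sum_ffunE.
transitivity (\sum_(s : {set 'I_n}) \sum_(v | (v \in s) && (t == s :\ v))
    (ksign K v t) *: c s).
  apply: eq_bigr => s _; rewrite ffunE /face_boundary sum_ffunE scaler_sumr.
  rewrite [RHS]big_mkcondr /=; apply: eq_bigr => v vs; rewrite !ffunE.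
  case: eqP => [->|_]; last by rewrite !scaler0.
  rewrite [_ *: 1%:R]mulr1 [LHS]mulrC; congr ((-1) ^+ _ *: _).
  by apply: eq_card => u; rewrite !inE; case: (u =P v) => //= ->; rewrite ltnn andbF.
rewrite (exchange_big_dep predT) //= [RHS]big_mkcond; apply: eq_bigr => v _.
case: ifPn => vt.
  rewrite (big_pred1 (v |: t)) ?mulr1 // => s /=.
  apply/andP/eqP => [[vs /eqP->]|->]; first by rewrite setD1K.
  by rewrite setU11 setU1K.
rewrite big_pred0 // => s; apply/negbTE/negP=> /andP[_ /eqP tE].
by move: vt; rewrite tE !inE eqxx.
Qed.

Lemma reduced_homology_eq0 E i :
  reduced_homology K E (i%:Z - 1) = 0%VS <-> simp_exact E i.
Proof.
have iE s : #|s|%:Z = i%:Z - 1 + 1 <-> #|s| = i by rewrite subrK; split=> [[]|->].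
have i1E s : #|s|%:Z = i%:Z - 1 + 1 + 1 <-> #|s| = i.+1.
  by rewrite subrK -[1]/(1%:Z) -PoszD addn1; split=> [[]|->].
have -> : reduced_homology K E (i%:Z - 1) = 0%VS <->
    (cycles K E (i%:Z - 1) <= boundaries K E (i%:Z - 1))%VS.
  by rewrite /reduced_homology -diffv_eq0; split=> /eqP.
split=> [/subvP H f fE f0|H].
  have /H/memv_imgP[g gE cE] : finfun f \in cycles K E (i%:Z - 1).
    rewrite memv_cap memv_ker; apply/andP; split.
      by apply/mem_chains=> s; rewrite ffunE => /fE[? ?]; split=> //; apply/iE.
    apply/eqP/ffunP=> t; rewrite boundaryE ffunE -[RHS](f0 t).
    by apply: eq_kdiff => s; rewrite ffunE.
  exists g; split=> [s|t]; first by move/mem_chains: gE => gE /gE[].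
  by rewrite -boundaryE -cE ffunE.
apply/subvP=> c; rewrite memv_cap memv_ker => /andP[/mem_chains cE /eqP c0].
have [s /cE[? /iE] //|t|g [gE g0]] := H c.
  by rewrite -boundaryE c0 ffunE.
(* [simp_exact] puts no size condition on [g]; only its values on faces of size [i.+1] affect those
   of size [i], so the others are dropped. *)
apply/memv_imgP; exists [ffun s : {set 'I_n} => if #|s| == i.+1 then g s else 0].
  apply/mem_chains=> s; rewrite ffunE; case: ifP => [/eqP ?|_]; last by rewrite eqxx.
  by move/gE; split=> //; apply/i1E.
apply/ffunP=> t; rewrite boundaryE -g0.
have [ti|ti] := eqVneq #|t| i.
  by apply: eq_bigr => v vt; rewrite ffunE cardsU1 vt ti eqxx.
have -> : simp g t = 0.
  by rewrite g0; apply/eqP; apply: contraNT ti => /cE[_ /iE ->].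
rewrite /kdiff big1 // => v vt.
by rewrite ffunE cardsU1 vt eqSS (negPf ti) scaler0.
Qed.

Lemma koszul_exact_link (i d : nat) :
  koszul_exact (fun=> 0%N) (ideal_row I) i d <->
  forall s, s \in D -> #|~: s| = d -> reduced_homology K (link D s) (i%:Z - 1) = 0%VS.
Proof.
rewrite koszul_exact_upper; split=> [ex s sD sd|ex b bd].
  by apply/reduced_homology_eq0; rewrite -upper_koszul_link; apply: ex; rewrite mdeg_mesym1.
(* If some exponent is at least 2 the complex is a cone; otherwise [b] is squarefree and determined
   by its support. *)
case: (pickP (fun v => 1 < b v)%N) => [v|b1]; first exact: upper_koszul_cone.
have bE : b = mesym1 (~: (~: mnm_supp b)).
  by apply/mnmP=> v; rewrite setCK mnmE inE; have := b1 v; case: (b v) => [|[]].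
rewrite bE upper_koszul_link; apply/reduced_homology_eq0.
case: (boolP (~: mnm_supp b \in D)) => sD.
  by apply: ex; rewrite // -bd {2}bE mdeg_mesym1.
(* The link of a non-face is the void complex, which is exact in every degree. *)
suff -> : link D (~: mnm_supp b) = set0.
  apply/reduced_homology_eq0=> f fE _; exists (fun=> 0); split=> [s|t].
    by rewrite eqxx.
  rewrite kdiff0; apply/esym/eqP; apply: contraT => /fE[]; by rewrite inE.
apply/setP=> t; rewrite !inE; apply/negbTE; apply: contra sD => /and3P[_ _].
by move/hD; apply; apply: subsetUl.
Qed.

End StanleyReisnerStrands.

(** * The dual Hochster formula and purity *)

Lemma betti_neq0 (K : fieldType) (n : nat) (D : {set {set 'I_n}}) (i d : nat) :
    simplicial_complex D ->
  betti (stanley_reisner_ideal K (alexander_dual D)) i d <> 0%N <->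
  exists s, [/\ s \in D, #|~: s| = d & reduced_homology K (link D s) (i%:Z - 1) != 0%VS].
Proof.
move=> hD; set I := stanley_reisner_ideal K _.
have [F FI] : exists F, minimal_graded_free_resolution I F.
  (* The bound [n] works because no [~: s] has more than [n] elements, which makes the condition on
     links vacuous. *)
  apply: (@minimal_resolution_exists _ _ _ n); first exact: stanley_reisner_graded.
  move=> j e en; apply/(koszul_exact_link K hD) => s _ se.
  by have := max_card (mem (~: s)); rewrite card_ord se leqNgt en.
(* [betti] reads off an unspecified minimal resolution [G]; the criterion applies to every such
   [G]. *)
have [G GI ->] : exists2 G, minimal_graded_free_resolution I G & betti I = resolution_betti G.
  apply: (@epsilon_spec _ _ (fun b => exists2 G, minimal_graded_free_resolution I G
    & b = resolution_betti G)).
  by exists (resolution_betti F), F.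
rewrite (resolution_betti_neq0 _ _ GI) koszul_exact_link //; split.
  move=> H; apply: NNPP => nex; apply: H => s sD sd; apply/eqP/negPn/negP=> hs.
  by apply: nex; exists s.
by move=> [s [sD sd hs]] H; rewrite H ?eqxx in hs.
Qed.

Theorem corollary4p8 (K : fieldType) (n : nat) (D : {set {set 'I_n}})
    (hD : simplicial_complex D) :
  pure_diagram (betti (stanley_reisner_ideal K (alexander_dual D))) <->
  (forall (i : int) (s t : {set 'I_n}), -1 <= i -> s \in D -> t \in D ->
     reduced_homology K (link D s) i != 0%VS ->
     reduced_homology K (link D t) i != 0%VS ->
     #|s| = #|t|).
Proof.
split=> [pure i s t i1 sD tD hs ht|H i c d].
  (* The link degree [i] belongs to resolution step [k = i + 1], a natural number since
     [-1 <= i]. *)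
  have [k kE] : exists k : nat, i = k%:Z - 1 by exists (absz (i + 1)); lia.
  rewrite kE in hs ht.
  (* Equal Betti degrees mean equal sizes of complements, hence of faces. *)
  have : #|~: s| = #|~: t|.
    by apply: (pure k); apply/betti_neq0 => //; [exists s | exists t].
  by have := cardsC s; have := cardsC t; lia.
move=> /(betti_neq0 K i c hD)[s [sD <- hs]] /(betti_neq0 K i d hD)[t [tD <- ht]].
have : #|s| = #|t| by apply: (H (i%:Z - 1)) => //; lia.
by have := cardsC s; have := cardsC t; lia.
Qed.
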